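(* Let $\mathcal{S}$ and $\mathcal{T}$ be operator systems. A linear map $\phi: \mathcal{S} \to \mathcal{T}$ is weak*-entanglement breaking if and only if $\phi: \operatorname{OMIN}(\mathcal{S}) \to \mathcal{T}$ is completely positive.
   Context: An (abstract) operator system is a triple $(V,\{C_n\}_{n\ge1},e)$: $V$ is a complex vector space with conjugate-linear involution $*$ (and $M_n(V)$ has involution $(a_{i,j})^*=(a_{j,i}^* )$); $C_n=M_n(V)^+$ are cones in $M_n(V)_h$ (hermitian elements) with $C_n\cap-C_n=\{0\}$ and $X^*C_nX\subseteq C_m$ for all $X\in M_{n,m}(\mathbb{C})$; and $e\in V_h$ is such that, for each $n$, $e_n=\operatorname{diag}(e,\dots,e)$ is an Archimedean order unit for $(M_n(V),C_n)$ (for each hermitian $A$ there is $r>0$ with $re_n-A\in C_n$; and $re_n+A\in C_n$ for all $r>0$ implies $A\in C_n$). A linear map $\phi$ between operator systems is completely positive if $\phi_n((v_{i,j}))=(\phi(v_{i,j}))$ maps the $n$-th cone into the $n$-th cone for every $n$. $\operatorname{OMIN}(\mathcal{S})$ is the operator system with the same underlying $*$-vector space and unit as $\mathcal{S}$ and cones $C_n^{\min}(\mathcal{S})=\{(v_{i,j})\in M_n(\mathcal{S}):\sum_{i,j}\overline{\lambda_i}\lambda_jv_{i,j}\in\mathcal{S}^+\ \forall\lambda_1,\dots,\lambda_n\in\mathbb{C}\}$, where $\mathcal{S}^+$ is the first-level cone of $\mathcal{S}$. Identify $M_n(\mathcal{S})=M_n\otimes\mathcal{S}$. A positive linear functional on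 $M_n(\mathcal{S})$ (nonnegative on $M_n(\mathcal{S})^+$) is weak*-separable if it is a weak*-limit (a limit of a net, pointwise on $M_n(\mathcal{S})$) of functionals that are finite sums of tensors $h\otimes g$ of positive linear functionals $h:M_n\to\mathbb{C}$, $g:\mathcal{S}\to\mathbb{C}$. A linear map $\phi:\mathcal{S}\to\mathcal{T}$ is weak*-entanglement breaking if for every $n\in\mathbb{N}$ and every positive linear functional $s:M_n(\mathcal{T})\to\mathbb{C}$, the functional $s\circ\phi_n:M_n(\mathcal{S})\to\mathbb{C}$ is a weak*-separable positive linear functional. *)

(* Defs.v *)
From HB Require Import structures.
From mathcomp Require Import all_boot all_order all_algebra.
From mathcomp Require Import all_classical all_reals.
From mathcomp Require Import topology normedtype.
From mathcomp Require Import complex.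

Set Implicit Arguments.
Unset Strict Implicit.
Unset Printing Implicit Defensive.
Import Order.TTheory GRing.Theory Num.Theory numFieldNormedType.Exports.
Local Open Scope classical_set_scope.
Local Open Scope complex_scope.
Local Open Scope ring_scope.

(* MathComp makes 'M[V]_n a module only over V, and only when V is a ring;
   for a complex vector space V the scalars must be taken in R[i]. *)
Definition matsp (V : Type) (n : nat) : Type := 'M[V]_n.

Section MatrixSpace.
Variables (R : realType) (V : lmodType R[i]) (n : nat).

HB.instance Definition _ := GRing.Zmodule.copy (matsp V n) 'M[V]_n.

Definition matsp_scale (a : R[i]) (A : matsp V n) : matsp V n :=
  map_mx ( *:%R a) A.

Fact matsp_scaleA a b A :
  matsp_scale a (matsp_scale b A) = matsp_scale (a * b) A.
Proof. by apply/matrixP => i j; rewrite !mxE scalerA. Qed.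

Fact matsp_scale1 : left_id 1 matsp_scale.
Proof. by move=> A; apply/matrixP => i j; rewrite !mxE scale1r. Qed.

Fact matsp_scaleDr : right_distributive matsp_scale +%R.
Proof. by move=> a A B; apply/matrixP => i j; rewrite !mxE scalerDr. Qed.

Fact matsp_scaleDl A : {morph matsp_scale^~ A : a b / a + b}.
Proof. by move=> a b; apply/matrixP => i j; rewrite !mxE scalerDl. Qed.

HB.instance Definition _ := GRing.Zmodule_isLmodule.Build R[i] (matsp V n)
  matsp_scaleA matsp_scale1 matsp_scaleDr matsp_scaleDl.

End MatrixSpace.

Section MatrixOrder.
Variables (R : realType) (V : lmodType R[i]).
Implicit Types (star : V -> V) (C : forall n, set (matsp V n)) (e : V).

Definition conj_linear_involution star : Prop :=
  (forall (a : R[i]) u v, star (a *: u + v) = Num.conj a *: star u + star v)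
  /\ involutive star.

Definition adjmx star n (A : matsp V n) : matsp V n :=
  \matrix_(i, j) star (A j i).

Definition hermitian star n (A : matsp V n) : Prop := adjmx star A = A.

(* X^* A X *)
Definition congrmx n m (X : 'M[R[i]]_(n, m)) (A : matsp V n) : matsp V m :=
  \matrix_(p, q) \sum_i \sum_j (Num.conj (X i p) * X j q) *: A i j.

Definition is_cone n (K : set (matsp V n)) : Prop :=
  [/\ K 0,
      forall A B, K A -> K B -> K (A + B) &
      forall (r : R) A, 0 <= r -> K A -> K (r%:C *: A)].

(* The value of C at n = 0 is never constrained nor used. *)
Definition matrix_ordering star C : Prop :=
  [/\ forall n, (0 < n)%N -> is_cone (C n),
      forall n A, (0 < n)%N -> C n A -> hermitian star A,
      forall n A, (0 < n)%N -> C n A -> C n (- A) -> A = 0 &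
      forall n m (X : 'M[R[i]]_(n, m)) A, (0 < n)%N -> (0 < m)%N ->
        C n A -> C m (congrmx X A)].

Definition archimedean_order_unit star n (K : set (matsp V n))
    (u : matsp V n) : Prop :=
  forall A, hermitian star A ->
    (exists2 r : R, 0 < r & K (r%:C *: u - A)) /\
    ((forall r : R, 0 < r -> K (r%:C *: u + A)) -> K A).

Definition archimedean_matrix_order_unit star C e : Prop :=
  star e = e /\
  forall n, (0 < n)%N -> archimedean_order_unit star (C n) e%:M.

End MatrixOrder.

Record opSystem (R : realType) := OpSystem {
  os_space :> lmodType R[i];
  os_star : os_space -> os_space;
  os_cone : forall n, set (matsp os_space n);
  os_unit : os_space;
  os_starP : conj_linear_involution os_star;
  os_coneP : matrix_ordering os_star os_cone;
  os_unitP : archimedean_matrix_order_unit os_star os_cone os_unit }.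

Section OperatorSystems.
Variable R : realType.
Implicit Types S T : opSystem R.

Definition os_pos S : set S := [set v | os_cone (const_mx v : matsp S 1)].

Definition amplify S T (phi : S -> T) n (A : matsp S n) : matsp T n :=
  map_mx phi A.

Definition completely_positive S T (phi : {linear S -> T}) : Prop :=
  forall n A, (0 < n)%N -> os_cone A -> os_cone (amplify phi (n := n) A).

Definition min_cone S n : set (matsp S n) :=
  [set A | forall lambda : 'I_n -> R[i],
     os_pos (\sum_i \sum_j (Num.conj (lambda i) * lambda j) *: A i j)].

End OperatorSystems.

Section MinimalOperatorSystem.
Variables (R : realType) (S : opSystem R).

Fact congrmx_comp n m p (X : 'M[R[i]]_(n, m)) (Y : 'M[R[i]]_(m, p))
    (A : matsp S n) : congrmx Y (congrmx X A) = congrmx (X *m Y) A.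
Proof.
apply/matrixP => a b; rewrite !mxE.
transitivity (\sum_k \sum_l \sum_i \sum_j
  (Num.conj (Y k a) * Y l b * (Num.conj (X i k) * X j l)) *: A i j).
  apply: eq_bigr => k _; apply: eq_bigr => l _; rewrite mxE scaler_sumr.
  by apply: eq_bigr => i _; rewrite scaler_sumr; apply: eq_bigr => j _; rewrite scalerA.
transitivity (\sum_i \sum_j \sum_k \sum_l
  (Num.conj (Y k a) * Y l b * (Num.conj (X i k) * X j l)) *: A i j).
  rewrite (eq_bigr (fun k => \sum_i \sum_j \sum_l
    (Num.conj (Y k a) * Y l b * (Num.conj (X i k) * X j l)) *: A i j)); last first.
    by move=> k _; rewrite exchange_big; apply: eq_bigr => i _; rewrite exchange_big.
  by rewrite exchange_big; apply: eq_bigr => i _; rewrite exchange_big.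
apply: eq_bigr => i _; apply: eq_bigr => j _.
rewrite !mxE rmorph_sum /= mulr_suml scaler_suml; apply: eq_bigr => k _.
rewrite mulr_sumr scaler_suml; apply: eq_bigr => l _.
congr (_ *: _); rewrite rmorphM /=.
by rewrite mulrACA; congr (_ * _); rewrite mulrC.
Qed.

Fact min_coneE n (A : matsp S n) :
  min_cone A <-> forall x : 'cV[R[i]]_n, os_cone (congrmx x A).
Proof.
have E (x : 'cV[R[i]]_n) : congrmx x A =
    const_mx (\sum_i \sum_j (Num.conj (x i 0) * x j 0) *: A i j).
  by apply/matrixP => a b; rewrite !mxE !ord1.
split=> H x; first by rewrite E; exact: H.
have := H (\col_i x i); rewrite E /os_pos /=.
by under eq_bigr do under eq_bigr do rewrite !mxE.
Qed.

Fact congrmxD n m (X : 'M[R[i]]_(n, m)) (A B : matsp S n) :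
  congrmx X (A + B) = congrmx X A + congrmx X B.
Proof.
apply/matrixP => a b; rewrite !mxE -big_split; apply: eq_bigr => i _.
by rewrite -big_split; apply: eq_bigr => j _; rewrite mxE scalerDr.
Qed.

Fact congrmxZ n m (X : 'M[R[i]]_(n, m)) c (A : matsp S n) :
  congrmx X (c *: A) = c *: congrmx X A.
Proof.
apply/matrixP => a b; rewrite !mxE scaler_sumr; apply: eq_bigr => i _.
rewrite scaler_sumr; apply: eq_bigr => j _.
by rewrite !mxE !scalerA mulrC.
Qed.

Fact congrmxN n m (X : 'M[R[i]]_(n, m)) (A : matsp S n) :
  congrmx X (- A) = - congrmx X A.
Proof. by rewrite -scaleN1r congrmxZ scaleN1r. Qed.

Fact congrmx0 n m (X : 'M[R[i]]_(n, m)) : congrmx X (0 : matsp S n) = 0.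
Proof. by rewrite -(scale0r (0 : matsp S n)) congrmxZ scale0r. Qed.

Fact os_star0 : os_star (0 : S) = 0.
Proof.
have [+ _] := os_starP S => /(_ (-1) 0 0).
by rewrite scaler0 addr0 rmorphN1 scaleN1r addNr.
Qed.

Fact os_starD (u v : S) : os_star (u + v) = os_star u + os_star v.
Proof.
by have [+ _] := os_starP S => /(_ 1 u v); rewrite rmorph1 !scale1r.
Qed.

Fact os_starZ a (u : S) : os_star (a *: u) = Num.conj a *: os_star u.
Proof.
by have [+ _] := os_starP S => /(_ a u 0); rewrite os_star0 !addr0.
Qed.

Fact os_star_sum (I : finType) (F : I -> S) :
  os_star (\sum_i F i) = \sum_i os_star (F i).
Proof. exact: (big_morph _ os_starD os_star0). Qed.

Fact adjmx_congr n m (X : 'M[R[i]]_(n, m)) (A : matsp S n) :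
  adjmx (@os_star R S) (congrmx X A) = congrmx X (adjmx (@os_star R S) A).
Proof.
apply/matrixP => a b; rewrite !mxE os_star_sum.
under eq_bigr do rewrite os_star_sum.
rewrite exchange_big; apply: eq_bigr => i _; apply: eq_bigr => j _.
by rewrite os_starZ mxE; congr (_ *: _); rewrite rmorphM /= conjCK mulrC.
Qed.

(* polarization *)
Fact congrmx_eq0 n (A : matsp S n) :
  (forall x : 'cV[R[i]]_n, congrmx x A = 0) -> A = 0.
Proof.
move=> A0.
pose B (x y : 'cV[R[i]]_n) : S := \sum_i \sum_j (Num.conj (x i 0) * y j 0) *: A i j.
have BE x : B x x = 0 by have /matrixP/(_ 0 0) := A0 x; rewrite !mxE.
have BDl x y z : B (x + y) z = B x z + B y z.
  rewrite -big_split; apply: eq_bigr => i _; rewrite -big_split.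
  by apply: eq_bigr => j _; rewrite mxE rmorphD mulrDl scalerDl.
have BDr x y z : B z (x + y) = B z x + B z y.
  rewrite -big_split; apply: eq_bigr => i _; rewrite -big_split.
  by apply: eq_bigr => j _; rewrite mxE mulrDr scalerDl.
have BZl c x z : B (c *: x) z = Num.conj c *: B x z.
  rewrite scaler_sumr; apply: eq_bigr => i _; rewrite scaler_sumr.
  by apply: eq_bigr => j _; rewrite mxE rmorphM scalerA mulrA.
have BZr c x z : B z (c *: x) = c *: B z x.
  rewrite scaler_sumr; apply: eq_bigr => i _; rewrite scaler_sumr.
  by apply: eq_bigr => j _; rewrite mxE scalerA mulrCA.
have Banti x y : B x y = - B y x.
  by apply/eqP; rewrite -addr_eq0 -(BE (x + y)) BDl !BDr !BE add0r addr0.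
have B0 x y : B x y = 0.
  have := Banti x ('i *: y); rewrite BZl BZr conjCi scaleNr opprK Banti scalerN.
  move/eqP; rewrite eq_sym -addr_eq0 -mulr2n -scaler_nat scalerA scaler_eq0.
  by rewrite mulf_eq0 pnatr_eq0 (negPf (neq0Ci _)) /= => /eqP yx0; rewrite yx0 oppr0.
apply/matrixP => k l; rewrite [RHS]mxE.
rewrite -[RHS](B0 (delta_mx k 0) (delta_mx l 0)) /B.
rewrite (bigD1 k) //= (bigD1 l) //= !mxE !eqxx rmorph1 mulr1 scale1r.
rewrite big1 ?addr0 => [|j jl]; last by rewrite !mxE (negPf jl) mulr0 scale0r.
rewrite big1 ?addr0 // => i ik; apply: big1 => j _.
by rewrite !mxE (negPf ik) rmorph0 mul0r scale0r.
Qed.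

Fact min_coneP : matrix_ordering (@os_star R S) (@min_cone R S).
Proof.
have [Kc Kh Kp Kx] := os_coneP S.
have [K0 KD KZ] := Kc 1 isT.
split.
- move=> n n0; split.
  + by apply/min_coneE => x; rewrite congrmx0.
  + move=> A B /min_coneE HA /min_coneE HB; apply/min_coneE => x.
    by rewrite congrmxD; apply: KD.
  + move=> r A r0 /min_coneE HA; apply/min_coneE => x.
    by rewrite congrmxZ; apply: KZ.
- move=> n A n0 /min_coneE HA; apply/eqP; rewrite -subr_eq0; apply/eqP.
  apply: congrmx_eq0 => x; rewrite congrmxD congrmxN -adjmx_congr.
  by apply/eqP; rewrite subr_eq0; apply/eqP; apply: Kh.
- move=> n A n0 /min_coneE HA /min_coneE HNA; apply: congrmx_eq0 => x.
  by apply: Kp => //; rewrite -congrmxN.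
- move=> n m X A n0 m0 /min_coneE HA; apply/min_coneE => x.
  by rewrite congrmx_comp.
Qed.

Fact congrmx_unit n (x : 'cV[R[i]]_n) :
  exists2 r : R, 0 <= r &
    congrmx x ((os_unit S)%:M : matsp S n) = r%:C *: ((os_unit S)%:M : matsp S 1).
Proof.
have N0 : 0 <= \sum_i Num.conj (x i 0) * x i 0 :> R[i].
  by apply: sumr_ge0 => i _; rewrite mulrC mul_conjC_ge0.
exists (complex.Re (\sum_i Num.conj (x i 0) * x i 0)).
  by move: N0; rewrite lecE => /andP[].
rewrite [_%:C](RRe_real (ger0_real N0)).
apply/matrixP => a b; rewrite !ord1 !mxE eqxx mulr1n scaler_suml.
apply: eq_bigr => i _; rewrite (bigD1 i) //= mxE eqxx mulr1n big1 ?addr0 // => j ji.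
by rewrite mxE eq_sym (negPf ji) mulr0n scaler0.
Qed.

Fact min_unitP :
  archimedean_matrix_order_unit (@os_star R S) (@min_cone R S) (os_unit S).
Proof.
have [Kc Kh Kp Kx] := os_coneP S.
have [K0 KD KZ] := Kc 1 isT.
have [eh eu] := os_unitP S; split=> // n n0 A Ah; split.
  have [[r r0 rA] _] := eu n n0 A Ah.
  by exists r => //; apply/min_coneE => x; apply: Kx.
move=> HA; apply/min_coneE => x.
have xAh : hermitian (@os_star R S) (congrmx x A) by rewrite /hermitian adjmx_congr Ah.
have [_] := eu 1 isT _ xAh; apply=> r r0.
have ue : os_cone ((os_unit S)%:M : matsp S 1).
  have h0 : hermitian (@os_star R S) (0 : matsp S 1).
    by apply/matrixP => i j; rewrite !mxE os_star0.
  have [[t t0 +] _] := eu 1 isT _ h0.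
  rewrite subr0 => /(KZ t^-1); rewrite scalerA -rmorphM mulVf ?gt_eqF//.
  by rewrite rmorph1 scale1r; apply; rewrite invr_ge0 ltW.
have [N N0 NE] := congrmx_unit x.
have N1 : 0 < N + 1 by rewrite ltr_wpDl.
have /min_coneE/(_ x) := HA (r / (N + 1)) (divr_gt0 r0 N1).
rewrite congrmxD congrmxZ NE scalerA -rmorphM => H.
have -> : r = r / (N + 1) * N + r / (N + 1).
  by rewrite -[X in _ + X]mulr1 -mulrDr divfK ?gt_eqF.
rewrite rmorphD scalerDl addrAC; apply: KD => //; apply: KZ => //.
by rewrite ltW // divr_gt0.
Qed.

Definition OMIN : opSystem R :=
  OpSystem (os_starP S) min_coneP min_unitP.

End MinimalOperatorSystem.

Section EntanglementBreaking.
Variable R : realType.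
Implicit Types S T : opSystem R.

Definition psdmx n (A : 'M[R[i]]_n) : Prop :=
  forall x : 'cV[R[i]]_n, 0 <= (map_mx Num.conj x^T *m A *m x) 0 0.

Definition positive_functional_Mn n (h : 'M[R[i]]_n -> R[i]) : Prop :=
  scalar h /\ forall A, psdmx A -> 0 <= h A.

Definition positive_functional S (g : S -> R[i]) : Prop :=
  scalar g /\ forall v, os_pos v -> 0 <= g v.

Definition positive_functional_mat S n (s : matsp S n -> R[i]) : Prop :=
  scalar s /\ forall A, os_cone A -> 0 <= s A.

(* h \otimes g under M_n(S) = M_n \otimes S,
   where A corresponds to the sum of the E_ij \otimes A_ij *)
Definition tensor_functional S n (h : 'M[R[i]]_n -> R[i]) (g : S -> R[i])
    (A : matsp S n) : R[i] :=
  \sum_i \sum_j h (delta_mx i j) * g (A i j).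

Definition separable_functional S n (s : matsp S n -> R[i]) : Prop :=
  exists (k : nat) (h : 'I_k -> 'M[R[i]]_n -> R[i]) (g : 'I_k -> S -> R[i]),
    [/\ forall l, positive_functional_Mn (h l),
        forall l, positive_functional (g l) &
        forall A, s A = \sum_l tensor_functional (h l) (g l) A].

Definition directed_preorder (I : Type) (le : I -> I -> Prop) : Prop :=
  [/\ inhabited I,
      forall i, le i i,
      forall i j k, le i j -> le j k -> le i k &
      forall i j, exists k, le i k /\ le j k].

Definition net_filter (I : Type) (le : I -> I -> Prop) : set_system I :=
  filter_from [set: I] (fun i => [set j | le i j]).

(* R[i]^o is R[i] with its norm topology *)
Definition weak_star_limit S n (P : (matsp S n -> R[i]) -> Prop)
    (s : matsp S n -> R[i]) : Prop :=
  exists (I : Type) (le : I -> I -> Prop) (f : I -> matsp S n -> R[i]),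
    [/\ directed_preorder le,
        forall i, P (f i) &
        forall A, (f i A : R[i]^o) @[i --> net_filter le] --> (s A : R[i]^o)].

Definition weak_star_separable S n (s : matsp S n -> R[i]) : Prop :=
  positive_functional_mat s /\
  weak_star_limit (@separable_functional S n) s.

Definition weak_star_entanglement_breaking S T (phi : {linear S -> T}) : Prop :=
  forall n (s : matsp T n -> R[i]), (0 < n)%N ->
    positive_functional_mat s ->
    weak_star_separable (s \o amplify phi (n := n)).

End EntanglementBreaking.

(* Main.v *)
(* Two separation arguments, both from Hahn-Banach for a real-valued sublinear
   functional on a complex space, give the two directions.
   Separating a point of [M_n(T)] from the cone by the gauge
   [inf {r | r e - 2 Re v >= 0}] shows that [A] is in the cone as soon as
   every positive functional is nonnegative at [A].  If [phi] is weak*-entanglement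
   breaking then [s \o phi_n] is a limit of sums of [h \otimes g], which are
   nonnegative on the minimal cone, so [phi_n] maps the minimal cone into the cone.
   Conversely, if [s] is nonnegative on the minimal cone but stays away from all
   separable functionals on finitely many matrices, separate it from them by the
   distance in [C^k]; this yields [B] with [Re (s B) > 0 >= Re (q B)] for all
   separable [q].  Testing on [q A = s' (congrmx x A)] puts [- Re B] in the minimal
   cone, contradicting the positivity of [s]. *)
Require Import Defs.
From mathcomp Require Import all_boot all_order all_algebra.
From mathcomp Require Import all_classical all_reals.
From mathcomp Require Import topology normedtype.
From mathcomp Require Import complex.
From mathcomp Require Import ring lra.
Import Defs.

Set Implicit Arguments.
Unset Strict Implicit.
Unset Printing Implicit Defensive.
Import Order.TTheory GRing.Theory Num.Theory numFieldNormedType.Exports.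
Import ComplexField.Normc.
Local Open Scope classical_set_scope.
Local Open Scope complex_scope.
Local Open Scope ring_scope.

(** * Hahn-Banach for real sublinear functionals on a complex space *)

Section HahnBanach.
Variables (R : realType) (V : lmodType R[i]).
Implicit Types (p q : V -> R) (E : V -> set R).

Definition sublinear p : Prop :=
  (forall u v, p (u + v) <= p u + p v) /\
  (forall (r : R) u, 0 < r -> p (r%:C *: u) <= r * p u).

Lemma scale_realA (r t : R) (u : V) : r%:C *: (t%:C *: u) = (r * t)%:C *: u.
Proof. by rewrite scalerA -rmorphM. Qed.

Lemma scale_realK (r : R) (u : V) : r != 0 -> r^-1%:C *: (r%:C *: u) = u.
Proof. by move=> r0; rewrite scale_realA mulVf // rmorph1 scale1r. Qed.

Lemma sublinear0 p : sublinear p -> p 0 = 0.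
Proof.
move=> [_ pZ].
have h2 := pZ 2 0 (ltr0n _ 2); have := pZ 2^-1 0; rewrite invr_gt0 ltr0n => /(_ isT).
by move: h2; rewrite !scaler0 => ? ?; lra.
Qed.

Lemma sublinearZ p (r : R) u : sublinear p -> 0 <= r -> p (r%:C *: u) = r * p u.
Proof.
move=> sp; rewrite le_eqVlt => /predU1P[<-|r0].
  by rewrite rmorph0 scale0r mul0r sublinear0.
apply/eqP; rewrite eq_le sp.2 //= -ler_pdivlMl //.
by rewrite -{1}[u](@scale_realK r) ?gt_eqF // sp.2 // invr_gt0.
Qed.

Lemma sublinear_geN p u : sublinear p -> - p (- u) <= p u.
Proof.
by move=> sp; have := sp.1 u (- u); rewrite subrr sublinear0 // => ?; lra.
Qed.

(** Common source of the sublinear functionals below: tilts, infima of chains, the gauge of a cone,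
    the distance to separable functionals. *)
Lemma sublinear_inf E :
  (forall u, has_inf (E u)) ->
  (forall u v a b, E u a -> E v b -> exists2 c, E (u + v) c & c <= a + b) ->
  (forall (r : R) u a, 0 < r -> E u a ->
     exists2 c, E (r%:C *: u) c & c <= r * a) ->
  sublinear (fun u => inf (E u)).
Proof.
move=> Einf ED EZ; split=> [u v|r u r0] /=.
  rewrite -lerBlDr; apply: lb_le_inf; first by have [] := Einf u.
  move=> a Ea; rewrite lerBlDl -lerBlDr.
  apply: lb_le_inf; first by have [] := Einf v.
  move=> b Eb; rewrite lerBlDl.
  have [c Ec] := ED _ _ _ _ Ea Eb; apply: le_trans.
  by apply: ge_inf => //; have [] := Einf (u + v).
rewrite mulrC -ler_pdivrMr //; apply: lb_le_inf; first by have [] := Einf u.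
move=> a Ea; rewrite ler_pdivrMr // mulrC.
have [c Ec] := EZ _ _ _ r0 Ea; apply: le_trans.
by apply: ge_inf => //; have [] := Einf (r%:C *: u).
Qed.

(** For sublinear [q], this is the largest sublinear functional below [q] whose value at [- v] is at
    most [- q v]. *)
Definition tilt q v u : R :=
  inf [set q (u + t%:C *: v) - t * q v | t in [set t | 0 <= t]].

Lemma tilt_has_inf q v u : sublinear q ->
  has_inf [set q (u + t%:C *: v) - t * q v | t in [set t | 0 <= t]].
Proof.
move=> sq; split; first by exists (q (u + 0%:C *: v) - 0 * q v); exists 0 => /=.
(* Subadditivity on [t v = - u + (u + t v)], with [q (t v) = t * q v], gives this bound. *)
exists (- q (- u)) => _ [t /= t0 <-].
have := sq.1 (- u) (u + t%:C *: v); rewrite addKr sublinearZ // => ?.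
by lra.
Qed.

Lemma tilt_sublinear q v : sublinear q -> sublinear (tilt q v).
Proof.
move=> sq; apply: sublinear_inf.
- by move=> u; apply: tilt_has_inf.
- move=> u w _ _ [t /= t0 <-] [z /= z0 <-].
  exists (q (u + w + (t + z)%:C *: v) - (t + z) * q v).
    by exists (t + z) => //=; apply: addr_ge0.
  have := sq.1 (u + t%:C *: v) (w + z%:C *: v).
  by rewrite addrACA -scalerDl -rmorphD => ?; lra.
- move=> r u _ r0 [t /= t0 <-].
  exists (q (r%:C *: u + (r * t)%:C *: v) - (r * t) * q v).
    by exists (r * t) => //=; rewrite mulr_ge0 // ltW.
  by rewrite -scale_realA -scalerDr sublinearZ ?(ltW r0) // mulrBr mulrA lexx.
Qed.

Lemma tilt_le q v u t : sublinear q -> 0 <= t ->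
  tilt q v u <= q (u + t%:C *: v) - t * q v.
Proof.
move=> sq t0; apply: ge_inf; last by exists t.
by have [] := tilt_has_inf v u sq.
Qed.

Lemma tilt_le_id q v u : sublinear q -> tilt q v u <= q u.
Proof.
move=> sq; have := tilt_le v u sq (lexx 0).
by rewrite rmorph0 scale0r addr0 mul0r subr0.
Qed.

(** Zorn's lemma for the reversed pointwise order. A chain has a finite pointwise infimum because
    each member is bounded below by [- p (- u)]. *)
Lemma minimal_sublinear p : sublinear p -> exists q,
  [/\ sublinear q, forall u, q u <= p u &
      forall q', sublinear q' -> (forall u, q' u <= q u) ->
        forall u, q u <= q' u].
Proof.
move=> sp.
pose T := {q : V -> R | sublinear q /\ forall u, q u <= p u}.
pose t0 : T := exist _ p (conj sp (fun u => lexx (p u))).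
pose le (a b : T) : bool := `[< forall u, sval b u <= sval a u >].
have sT (a : T) : sublinear (sval a) by case: a => ? [].
have bT (a : T) u : sval a u <= p u by case: a => ? [].
have [//|a b c /asboolP ab /asboolP bc||[q [sq qp]] qmax] := @ZL_preorder T t0 le.
- by move=> a; apply/asboolP => u.
- by apply/asboolP => u; apply: le_trans (ab u).
- move=> A Atot; have [[a0 Aa0]|A0] := pselect (A !=set0); last first.
    by exists t0 => s As; case: A0; exists s.
  pose E u := [set sval a u | a in A].
  have Einf u : has_inf (E u).
    split; first by exists (sval a0 u); exists a0.
    exists (- p (- u)) => _ [a _ <-].
    by apply: le_trans (sublinear_geN u (sT a)); rewrite lerN2.
  have Ele a u : A a -> inf (E u) <= sval a u.
    by move=> Aa; apply: ge_inf; [have [] := Einf u|exists a].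
  have sE : sublinear (fun u => inf (E u)).
    apply: sublinear_inf => //.
    + move=> u v _ _ [a Aa <-] [b Ab <-].
      (* Of two members of the chain, the smaller is subadditive and lies below the other. *)
      have [/asboolP ab|/asboolP ba] := Atot _ _ Aa Ab.
        exists (sval b (u + v)); first by exists b.
        by apply: le_trans ((sT b).1 u v) _; rewrite lerD2r.
      exists (sval a (u + v)); first by exists a.
      by apply: le_trans ((sT a).1 u v) _; rewrite lerD2l.
    + move=> r u _ r0 [a Aa <-]; exists (sval a (r%:C *: u)); first by exists a.
      exact: (sT a).2.
  have bE u : inf (E u) <= p u by apply: le_trans (Ele _ _ Aa0) (bT _ _).
  exists (exist _ (fun u => inf (E u)) (conj sE bE)) => a Aa.
  by apply/asboolP => u /=; apply: Ele.
- exists q; split=> // q' sq' q'q.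
  have q'p u : q' u <= p u by apply: le_trans (q'q u) (qp u).
  have := qmax (exist _ q' (conj sq' q'p)); rewrite /le /= => qmax'.
  by apply/asboolP; apply: qmax'; apply/asboolP.
Qed.

(* A minimal [q] satisfies [q <= tilt q v], which at [t = 1] is superadditivity. *)
Lemma real_hahn_banach p : sublinear p -> exists f : V -> R,
  [/\ forall u v, f (u + v) = f u + f v,
      forall (r : R) u, f (r%:C *: u) = r * f u &
      forall u, f u <= p u].
Proof.
move=> /minimal_sublinear[q [sq qp qmin]].
have qD u v : q (u + v) = q u + q v.
  apply/eqP; rewrite eq_le sq.1 /=.
  have h1 := qmin _ (tilt_sublinear v sq) (fun w => tilt_le_id v w sq) u.
  by have := tilt_le v u sq ler01; rewrite rmorph1 scale1r mul1r => h2; lra.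
have qN u : q (- u) = - q u.
  by apply/eqP; rewrite -addr_eq0 -qD addNr sublinear0.
exists q; split=> // r u; have [r0|/ltW r0] := leP 0 r; first exact: sublinearZ.
by rewrite -[r]opprK rmorphN scaleNr qN sublinearZ ?oppr_ge0 // -mulNr.
Qed.

(** Domination by [tilt p v0] forces equality at [v0]: it gives [f (- v0) <= - p v0] as well as
    [f v0 <= p v0]. *)
Lemma hahn_banach p v0 : sublinear p -> exists g : V -> R[i],
  [/\ scalar g, forall u, complex.Re (g u) <= p u & complex.Re (g v0) = p v0].
Proof.
move=> sp; have [f [fD fZ fp]] := real_hahn_banach (tilt_sublinear v0 sp).
have f0 : f 0 = 0 by have := fZ 0 0; rewrite scaler0 mul0r.
have fN u : f (- u) = - f u by apply/eqP; rewrite -addr_eq0 -fD addNr f0.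
have fle u : f u <= p u by apply: le_trans (fp u) (tilt_le_id v0 u sp).
(* The complex-linear functional with real part [f] is [f u - i f (i u)]. *)
exists (fun u => (f u +i* - f ('i%C *: u))%C); split => //=; last first.
  apply/eqP; rewrite eq_le fle /= -lerN2 -fN.
  apply: le_trans (fp _) _; apply: le_trans (tilt_le v0 (- v0) sp ler01) _.
  by rewrite rmorph1 scale1r addNr sublinear0 // mul1r sub0r.
case=> x y u v.
have aE : (x +i* y)%C = x%:C + y%:C * 'i%C :> R[i].
  by rewrite mulrC [LHS]complexE.
have fa w : f ((x +i* y)%C *: w) = x * f w + y * f ('i%C *: w).
  by rewrite aE scalerDl -scalerA fD !fZ.
have iiN w : 'i%C *: ('i%C *: w) = - w :> V.
  by rewrite scalerA -expr2 sqr_i scaleN1r.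
have fia w : f ('i%C *: ((x +i* y)%C *: w)) = x * f ('i%C *: w) - y * f w.
  by rewrite scalerA mulrC -scalerA fa iiN fN mulrN.
rewrite scalerDr !fD fa fia.
apply/eqP; rewrite eq_complex /=; apply/andP; split; apply/eqP; ring.
Qed.

End HahnBanach.

(** * Algebra of complex-linear functionals *)

Section ScalarFunctions.
Variables (R : realType) (V : lmodType R[i]) (f : V -> R[i]).
Hypothesis fP : scalar f.

Lemma scalar_fun0 : f 0 = 0.
Proof. by have := fP (-1) 0 0; rewrite scaler0 addr0 mulN1r addNr. Qed.

Lemma scalar_funD u v : f (u + v) = f u + f v.
Proof. by have := fP 1 u v; rewrite scale1r mul1r. Qed.

Lemma scalar_funZ a u : f (a *: u) = a * f u.
Proof. by have := fP a u 0; rewrite scalar_fun0 !addr0. Qed.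

Lemma scalar_funN u : f (- u) = - f u.
Proof. by rewrite -scaleN1r scalar_funZ mulN1r. Qed.

Lemma scalar_fun_sum (I : finType) (F : I -> V) : f (\sum_i F i) = \sum_i f (F i).
Proof. exact: (big_morph _ scalar_funD scalar_fun0). Qed.

End ScalarFunctions.

(** * Positive functionals determine the matrix cones *)

Section PositiveFunctionals.
Variables (R : realType) (S : opSystem R).

Lemma adjmxD n (A B : matsp S n) :
  adjmx (@os_star R S) (A + B) = adjmx (@os_star R S) A + adjmx (@os_star R S) B.
Proof. by apply/matrixP => i j; rewrite !mxE os_starD. Qed.

Lemma adjmxZ n a (A : matsp S n) :
  adjmx (@os_star R S) (a *: A) = Num.conj a *: adjmx (@os_star R S) A.
Proof. by apply/matrixP => i j; rewrite !mxE os_starZ. Qed.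

Lemma adjmxN n (A : matsp S n) :
  adjmx (@os_star R S) (- A) = - adjmx (@os_star R S) A.
Proof. by rewrite -scaleN1r adjmxZ rmorphN rmorph1 scaleN1r. Qed.

Lemma adjmxK n : involutive (@adjmx R S (@os_star R S) n).
Proof.
by have [_ starK] := os_starP S; move=> A; apply/matrixP => i j; rewrite !mxE starK.
Qed.

Lemma conj_real_complex (r : R) : Num.conj (r%:C) = r%:C :> R[i].
Proof. by apply: conj_Creal; rewrite complex_real. Qed.

Lemma hermitianDadj n (A : matsp S n) :
  hermitian (@os_star R S) (A + adjmx (@os_star R S) A).
Proof. by rewrite /hermitian adjmxD adjmxK addrC. Qed.

Lemma hermitian_iBadj n (A : matsp S n) :
  hermitian (@os_star R S) ('i *: (A - adjmx (@os_star R S) A)).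
Proof.
rewrite /hermitian adjmxZ adjmxD adjmxN adjmxK. rewrite conjCi. by rewrite scaleNr -scalerN opprB.
Qed.

Lemma os_cone_unit n : (0 < n)%N -> os_cone ((os_unit S)%:M : matsp S n).
Proof.
move=> n0; have [Kc _ _ _] := os_coneP S; have [K0 KD KZ] := Kc n n0.
have [_ eu] := os_unitP S.
have h0 : hermitian (@os_star R S) (0 : matsp S n).
  by apply/matrixP => i j; rewrite !mxE os_star0.
have [[t t0 +] _] := eu n n0 _ h0.
rewrite subr0 => /(KZ t^-1); rewrite scale_realK ?gt_eqF //; apply.
by rewrite invr_ge0 ltW.
Qed.

Lemma os_cone_min_cone n (A : matsp S n) : (0 < n)%N -> os_cone A -> min_cone A.
Proof.
move=> n0 KA; apply/min_coneE => x.
by have [_ _ _ Kx] := os_coneP S; apply: Kx.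
Qed.

(** [A = r e - (r e - A)] is a difference of cone elements, at which [s] is real. *)
Lemma positive_functional_hermitian n (s : matsp S n -> R[i]) A : (0 < n)%N ->
  positive_functional_mat s -> hermitian (@os_star R S) A -> s A \is Num.real.
Proof.
move=> n0 [sl s0] hA; have [_ /(_ n n0)/(_ _ hA)[[r r0 rA] _]] := os_unitP S.
have := s0 _ rA; rewrite scalar_funD // scalar_funN // scalar_funZ // => /ger0_real h.
have : r%:C * s (os_unit S)%:M \is Num.real.
  by rewrite realM // ?ger0_real ?s0 ?ler0c ?ltW //; apply: os_cone_unit.
by move=> /realB/(_ h); rewrite opprB addrCA subrr addr0.
Qed.

(** [s] is real at the hermitian elements [A + adjmx A] and [i (A - adjmx A)]; this makes the real
    parts equal and the imaginary parts opposite. *)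
Lemma positive_functional_adj n (s : matsp S n -> R[i]) A : (0 < n)%N ->
  positive_functional_mat s ->
  s (adjmx (@os_star R S) A) = Num.conj (s A).
Proof.
move=> n0 ps; have [sl _] := ps.
have := positive_functional_hermitian n0 ps (hermitianDadj A).
have := positive_functional_hermitian n0 ps (hermitian_iBadj A).
rewrite (scalar_funZ sl) !(scalar_funD sl) (scalar_funN sl).
case: (s A) => a b; case: (s _) => c d.
rewrite -complexiE; simpc; rewrite !complex_real => /eqP h1 /eqP h2.
by apply/eqP; rewrite eq_complex /=; apply/andP; split; apply/eqP; lra.
Qed.

(** Hahn-Banach at [- A] gives a positive [g] with [Re (g (- A))] equal to the gauge of [- A]. As
    [g A >= 0], that gauge is at most [0], so [r e + A] is in the cone for all [r > 0] and the
    Archimedean axiom applies. *)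
Lemma positive_separation_hermitian n (A : matsp S n) : (0 < n)%N ->
  hermitian (@os_star R S) A ->
  (forall s : matsp S n -> R[i], positive_functional_mat s -> 0 <= s A) ->
  os_cone A.
Proof.
move=> n0 hA sA; have [Kc Kh Kp _] := os_coneP S; have [K0 KD KZ] := Kc n n0.
have [_ /(_ n n0) eu] := os_unitP S.
have Ku := os_cone_unit n0.
pose e : matsp S n := (os_unit S)%:M.
pose st := @adjmx R S (@os_star R S) n.
have [KN|nKN] := pselect (os_cone (- e)).
  (* Here [e = 0], and the gauge below would be unbounded below. *)
  have e0 : e = 0 by apply: Kp.
  have hNA : hermitian (@os_star R S) (- A) by rewrite /hermitian adjmxN hA.
  by have [[r _]] := eu _ hNA; rewrite -/e e0 scaler0 sub0r opprK.
pose E (v : matsp S n) : set R := [set r | os_cone (r%:C *: e - (v + st v))].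
have Einf v : has_inf (E v).
  split.
    by have [[r _ Kr] _] := eu _ (hermitianDadj v); exists r.
  have hN : hermitian (@os_star R S) (- (v + st v)).
    by rewrite /hermitian adjmxN hermitianDadj.
  have [[t _ +] _] := eu _ hN; rewrite opprK => Kt.
  (* A value below [- t] would put a negative multiple of [e] in the cone, against [nKN]. *)
  exists (- t) => r /= Er; rewrite leNgt; apply/negP => rt; apply: nKN.
  have := KD _ _ Er Kt; rewrite addrACA addNr addr0 -scalerDl -rmorphD => Krt.
  have {}rt : 0 < - (r + t) by lra.
  have := KZ (- (r + t))^-1 _ _ Krt; rewrite invr_ge0 (ltW rt) => /(_ isT).
  by rewrite invrN rmorphN scaleNr scale_realK // -oppr_eq0 gt_eqF.
have sE : sublinear (fun v => inf (E v)).
  apply: sublinear_inf => //.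
  - move=> u v a b Ea Eb; exists (a + b) => //=.
    have := KD _ _ Ea Eb; congr os_cone.
    by rewrite /st adjmxD rmorphD scalerDl (addrACA u) [in RHS]opprD addrACA.
  - move=> r u a r0 Ea; exists (r * a) => //=.
    have := KZ r _ (ltW r0) Ea; congr os_cone.
    by rewrite scalerBr scale_realA scalerDr /st adjmxZ conj_real_complex.
have [g [gl gle gA]] := hahn_banach (- A) sE.
have gle0 v : os_cone (- (v + st v)) -> complex.Re (g v) <= 0.
  move=> Kv; apply: le_trans (gle v) _; apply: ge_inf; first by have [] := Einf v.
  by rewrite /E /= rmorph0 scale0r sub0r.
have gpos : positive_functional_mat g.
  split=> // B KB; have hB := Kh _ _ n0 KB.
  (* Both ['i *: B] and its negative have zero hermitian part, so [Re g <= 0] at both; hence [g B]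
     is real. *)
  have := gle0 ('i *: B); have := gle0 (- ('i *: B)).
  have := gle0 (- B); rewrite !(scalar_funN gl) (scalar_funZ gl).
  rewrite /st !adjmxN !adjmxZ hB conjCi scaleNr opprK addrN oppr0 -opprD opprK.
  rewrite addNr oppr0.
  move=> /(_ (KD _ _ KB KB)) h1 /(_ K0) h2 /(_ K0); move: h1 h2.
  case: (g B) => a b; rewrite -complexiE /=; simpc => /= h1 h2 h3.
  by apply/andP; split; [apply/eqP|]; lra.
have [_ KA] := eu _ hA; apply: KA => r r0.
(* The factor [2] appears because [E] measures [v + st v], twice the hermitian part. *)
have pA : inf (E (- A)) < r * 2.
  have := sA _ gpos; rewrite -gA (scalar_funN gl).
  by case: (g A) => a b; simpc => /andP[_ a0] /=; lra.
have [t /= Et tr] := inf_lt (proj1 (Einf (- A))) pA.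
have Kt : os_cone ((r * 2 - t)%:C *: e) by apply: KZ => //; lra.
have := KZ 2^-1 _ _ (KD _ _ Kt Et); rewrite invr_ge0 ler0n => /(_ isT).
congr os_cone; rewrite addrA -scalerDl -rmorphD subrK /st adjmxN hA -opprD opprK.
have -> : A + A = 2%:C *: A :> matsp S n.
  by rewrite (rmorph_nat (real_complex R)) scaler_nat.
rewrite mulrC.
by rewrite -scale_realA -scalerDr scale_realK // pnatr_eq0.
Qed.

(** Positivity at [A] forces [A] to be hermitian: every positive [s] vanishes at [i (A - adjmx A)],
    so this element and its negative both lie in the cone. *)
Lemma positive_separation n (A : matsp S n) : (0 < n)%N ->
  (forall s : matsp S n -> R[i], positive_functional_mat s -> 0 <= s A) ->
  os_cone A.
Proof.
move=> n0 sA; apply: positive_separation_hermitian => //.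
have [_ _ Kp _] := os_coneP S.
have sD (s : matsp S n -> R[i]) : positive_functional_mat s ->
    s ('i *: (A - adjmx (@os_star R S) A)) = 0.
  move=> ps; have [sl _] := ps; have := ger0_real (sA _ ps).
  rewrite (scalar_funZ sl) (scalar_funD sl) (scalar_funN sl) (positive_functional_adj _ n0 ps).
  by move=> /conj_Creal->; rewrite subrr mulr0.
have D0 : 'i *: (A - adjmx (@os_star R S) A) = 0.
  apply: Kp => //; apply: positive_separation_hermitian => //.
  - exact: hermitian_iBadj.
  - by move=> s ps; rewrite sD.
  - by rewrite /hermitian adjmxN hermitian_iBadj.
  - by move=> s ps; have [sl _] := ps; rewrite (scalar_funN sl) sD // oppr0.
move/eqP: D0; rewrite scaler_eq0 (negPf (neq0Ci _)) /= subr_eq0 => /eqP.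
by rewrite /hermitian => <-.
Qed.

End PositiveFunctionals.

(** * Nets, separable functionals and the minimal cone *)

Lemma net_filter_proper (I : Type) (le : I -> I -> Prop) :
  directed_preorder le -> ProperFilter (net_filter le).
Proof.
move=> [[i0] le_refl le_tr le_dir]; apply: filter_from_proper.
  apply: filter_from_filter; first by exists i0.
  move=> i j _ _; have [k [ik jk]] := le_dir i j; exists k => // l kl.
  by split; [apply: le_tr ik kl|apply: le_tr jk kl].
by move=> i _; exists i; apply: le_refl.
Qed.

Section Separable.
Variables (R : realType) (S : opSystem R) (n : nat).
Implicit Types (q s : matsp S n -> R[i]) (A : matsp S n).

Lemma separable_scalar q : separable_functional q -> scalar q.
Proof.
move=> [k [h [g [_ gp qE]]]] a u v; rewrite !qE mulr_sumr -big_split /=.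
apply: eq_bigr => l _; rewrite mulr_sumr -big_split; apply: eq_bigr => i _.
rewrite /= mulr_sumr -big_split; apply: eq_bigr => j _ /=.
by rewrite !mxE (proj1 (gp l)) mulrDr mulrCA.
Qed.

Lemma separable0 : separable_functional (fun _ : matsp S n => 0).
Proof.
exists 0, (fun _ _ => 0), (fun _ _ => 0); split=> [[]//|[]//|A].
by rewrite big_ord0.
Qed.

Lemma separableD q1 q2 : separable_functional q1 -> separable_functional q2 ->
  separable_functional (fun A => q1 A + q2 A).
Proof.
move=> [k1 [h1 [g1 [hp1 gp1 E1]]]] [k2 [h2 [g2 [hp2 gp2 E2]]]].
exists (k1 + k2)%N,
  (fun l => match fintype.split l with inl l1 => h1 l1 | inr l2 => h2 l2 end),
  (fun l => match fintype.split l with inl l1 => g1 l1 | inr l2 => g2 l2 end).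
split=> [l|l|A]; [by case: (fintype.split l)|by case: (fintype.split l)|].
rewrite E1 E2 big_split_ord /=; congr (_ + _); apply: eq_bigr => l _.
  by rewrite (unsplitK (inl l)).
by rewrite (unsplitK (inr l)).
Qed.

Lemma separableZ (r : R) q : 0 <= r -> separable_functional q ->
  separable_functional (fun A => r%:C * q A).
Proof.
move=> r0 [k [h [g [hp gp E]]]].
exists k, h, (fun l v => r%:C * g l v); split=> // [l|A].
  have [gl g0] := gp l; split=> [a u v|v v0]; first by rewrite gl mulrDr mulrCA.
  by rewrite mulr_ge0 ?g0 // ler0c.
rewrite E mulr_sumr; apply: eq_bigr => l _; rewrite mulr_sumr.
apply: eq_bigr => i _; rewrite mulr_sumr; apply: eq_bigr => j _.
by rewrite mulrCA.
Qed.

(** This is a single tensor: [h] sends [B] to [x^* B x], and [g] is [s] on 1-by-1 matrices. *)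
Lemma separable_congr (s : matsp S 1 -> R[i]) (x : 'cV[R[i]]_n) :
  positive_functional_mat s -> separable_functional (fun A => s (congrmx x A)).
Proof.
move=> [sl s0].
exists 1%N, (fun _ B => (map_mx Num.conj x^T *m B *m x) 0 0),
  (fun _ v => s (const_mx v)).
split=> [_|_|A].
- split=> [a B C|B]; last exact.
  by rewrite mulmxDr mulmxDl -scalemxAr -scalemxAl !mxE.
- split=> [a u v|v]; last exact: s0.
  by rewrite -sl; congr s; apply/matrixP => i j; rewrite !mxE.
- rewrite big_ord1 /tensor_functional.
  have -> : congrmx x A =
      \sum_i \sum_j (Num.conj (x i 0) * x j 0) *: (const_mx (A i j) : matsp S 1).
    apply/matrixP => a b; rewrite !ord1 !mxE summxE; apply: eq_bigr => i _.
    by rewrite summxE; apply: eq_bigr => j _; rewrite !mxE.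
  rewrite (scalar_fun_sum sl); apply: eq_bigr => i _.
  rewrite (scalar_fun_sum sl); apply: eq_bigr => j _; rewrite (scalar_funZ sl).
  (* For the matrix unit [E_ij], [x^* E_ij x] is the conjugate of [x_i] times [x_j]. *)
  congr (_ * _); rewrite mxE (bigD1 j) //= big1 ?addr0 => [|l lj].
    rewrite mxE (bigD1 i) //= big1 ?addr0 => [|l li].
      by rewrite !mxE !eqxx mulr1.
    by rewrite !mxE (negPf li) mulr0.
  by rewrite mxE big1 ?mul0r // => m _; rewrite !mxE (negPf lj) andbF mulr0.
Qed.

(* [(h \otimes g) A = h (g A)], and [g A] is a positive semidefinite matrix. *)
Lemma separable_min_cone q A :
  separable_functional q -> min_cone A -> 0 <= q A.
Proof.
move=> [k [h [g [hp gp ->]]]] mA; apply: sumr_ge0 => l _.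
have [hl h0] := hp l; have [gl g0] := gp l.
pose B : 'M[R[i]]_n := \matrix_(i, j) g l (A i j).
have -> : tensor_functional (h l) (g l) A = h l B.
  rewrite [B]matrix_sum_delta (scalar_fun_sum hl); apply: eq_bigr => i _.
  rewrite (scalar_fun_sum hl); apply: eq_bigr => j _.
  by rewrite (scalar_funZ hl) mxE mulrC.
apply: h0 => x; have := g0 _ (mA (fun i => x i 0)).
rewrite (scalar_fun_sum gl) mxE; congr (_ <= _).
rewrite (eq_bigr (fun i => \sum_j Num.conj (x i 0) * x j 0 * g l (A i j))).
  rewrite exchange_big; apply: eq_bigr => j _; rewrite mxE mulr_suml.
  by apply: eq_bigr => i _; rewrite !mxE mulrAC.
move=> i _; rewrite (scalar_fun_sum gl); apply: eq_bigr => j _.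
by rewrite (scalar_funZ gl).
Qed.

(** At the compression of [A + adjmx A] by [x], a positive [s] takes twice the real part of a
    separable functional at [A]; such [s] detect the cone at level one. *)
Lemma separable_bipolar A : (0 < n)%N ->
  (forall q, separable_functional q -> complex.Re (q A) <= 0) ->
  min_cone (- (A + adjmx (@os_star R S) A)).
Proof.
move=> n0 qA; apply/min_coneE => x; apply: positive_separation => // s ps.
have [sl _] := ps; have := qA _ (separable_congr x ps).
rewrite congrmxN congrmxD -adjmx_congr (scalar_funN sl) (scalar_funD sl).
rewrite (positive_functional_adj _ _ ps) //.
by case: (s _) => a b /= a0; rewrite /Num.conj /=; simpc; lra.
Qed.

(** Separable functionals form a convex cone, so the l1 distance in [C^k] to their value vectors is
    sublinear. If no [q] is close, this distance is at least [eps] at the values of [s]. *)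
Lemma separable_approx s k (A : 'I_k -> matsp S n) (eps : R) : (0 < n)%N ->
  scalar s -> (forall B, min_cone B -> 0 <= s B) -> 0 < eps ->
  exists2 q, separable_functional q & forall i, normc (q (A i) - s (A i)) < eps.
Proof.
move=> n0 sl s0 eps0; apply: contrapT => nq.
pose d (x : 'rV[R[i]]_k) q := \sum_i normc (x 0 i - q (A i)).
have d0 x q : 0 <= d x q by apply: sumr_ge0 => i _; apply: normr_ge0 (_ : Rcomplex R).
pose E (x : 'rV[R[i]]_k) : set R := [set d x q | q in @separable_functional R S n].
have Einf x : has_inf (E x).
  split; first by exists (d x (fun=> 0)); exists (fun=> 0) => //; apply: separable0.
  by exists 0 => _ [q _ <-].
have sE : sublinear (fun x => inf (E x)).
  apply: sublinear_inf => //.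
  - move=> x y _ _ [q1 sq1 <-] [q2 sq2 <-].
    exists (d (x + y) (fun B => q1 B + q2 B)).
      by exists (fun B => q1 B + q2 B) => //; apply: separableD.
    rewrite -big_split /=; apply: ler_sum => i _.
    by rewrite mxE opprD addrACA le_normcD.
  - move=> r x _ r0 [q sq <-]; exists (d (r%:C *: x) (fun B => r%:C * q B)).
      by exists (fun B => r%:C * q B) => //; apply: separableZ => //; apply: ltW.
    rewrite mulr_sumr; apply: ler_sum => i _.
    by rewrite mxE -mulrBr normcM /normc /= expr0n addr0 sqrtr_sqr gtr0_norm.
pose x0 : 'rV[R[i]]_k := \row_i s (A i).
have [g [gl gle gx0]] := hahn_banach x0 sE.
(* [g] pairs a vector with fixed coefficients; combining the [A i] with these turns [g] into
   evaluation at one matrix. *)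
pose B : matsp S n := \sum_i g (delta_mx 0 i) *: A i.
have gB q : scalar q -> g (\row_i q (A i)) = q B.
  move=> ql; rewrite [\row_i _]row_sum_delta (scalar_fun_sum gl) (scalar_fun_sum ql).
  by apply: eq_bigr => i _; rewrite (scalar_funZ gl) (scalar_funZ ql) mxE mulrC.
have sB : eps <= complex.Re (s B).
  rewrite -gB // gx0; apply: lb_le_inf; first by have [] := Einf x0.
  move=> _ [q sq <-]; rewrite leNgt; apply/negP => dq; apply: nq; exists q => // i.
  (* Each coordinate is bounded by the l1 distance. *)
  apply: le_lt_trans dq; rewrite -normcN opprB /d (bigD1 i) //= mxE lerDl.
  by apply: sumr_ge0 => j _; apply: normr_ge0 (_ : Rcomplex R).
have /s0 : min_cone (- (B + adjmx (@os_star R S) B)).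
  apply: separable_bipolar => // q sq; rewrite -gB; last exact: separable_scalar.
  apply: le_trans (gle _) _.
  (* [q] lies at distance [0] from its own value vector. *)
  have -> : 0 = d (\row_i q (A i)) q.
    by rewrite /d big1 // => i _; rewrite mxE subrr normc0.
  by apply: ge_inf; [have [] := Einf (\row_i q (A i))|exists q].
have ps : positive_functional_mat s.
  by split=> // C KC; apply: s0; apply: os_cone_min_cone.
rewrite (scalar_funN sl) (scalar_funD sl) (positive_functional_adj _ n0 ps).
by move: sB; case: (s B) => a b /=; rewrite /Num.conj /=; simpc; lra.
Qed.

(** The net is indexed by a finite list of matrices and a precision [m]; its member is within
    [1 / (m + 1)] of [s] on the list. *)
Lemma min_positive_weak_star_limit s : (0 < n)%N ->
  scalar s -> (forall B, min_cone B -> 0 <= s B) ->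
  weak_star_limit (@separable_functional R S n) s.
Proof.
move=> n0 sl s0.
have ap (i : seq (matsp S n) * nat) : exists q, separable_functional q /\
    forall A, A \in i.1 -> normc (q A - s A) < i.2.+1%:R^-1.
  have [|q sq qs] := separable_approx (tnth (in_tuple i.1)) n0 sl s0 (_ : 0 < i.2.+1%:R^-1).
    by rewrite invr_gt0 ltr0n.
  exists q; split=> // A Ai; have /tnthP[j ->] : A \in in_tuple i.1 by [].
  exact: qs.
have [f fP] := choice ap.
pose le (i j : seq (matsp S n) * nat) := {subset i.1 <= j.1} /\ (i.2 <= j.2)%N.
have le_dir : directed_preorder le.
  split.
  - by constructor; exact: ([::], 0%N).
  - by move=> i; split.
  - move=> i j l [ij1 ij2] [jl1 jl2]; split; last exact: leq_trans jl2.
    by move=> A /ij1/jl1.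
  - move=> i j; exists (i.1 ++ j.1, maxn i.2 j.2).
    by split; split=> /= [A iA|]; rewrite ?mem_cat ?iA ?orbT ?leq_maxl ?leq_maxr.
have lePF := net_filter_proper le_dir.
exists (seq (matsp S n) * nat)%type, le, f; split=> //.
- by move=> i; have [] := fP i.
- move=> A; apply/cvgrPdist_lt => e e0.
  (* Radii are taken in [R[i]], where a positive element is real. *)
  have e1 : 0 < complex.Re e by case: e e0 => a b; simpc => /andP[].
  have eE : e = (complex.Re e)%:C by rewrite RRe_real // gtr0_real.
  (* Chosen so that [1 / (N + 1) < Re e]. *)
  pose N := Num.truncn (complex.Re e)^-1.
  exists ([:: A], N) => // i [/= Ai Ni].
  have [_ /(_ A)] := fP i; rewrite Ai ?mem_head // => /(_ isT) fi.
  rewrite distrC eE ltcR; apply: lt_le_trans fi _.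
  rewrite invf_ple ?posrE ?ltr0n //; apply: ltW.
  apply: lt_le_trans (truncnS_gt _) _; rewrite ler_nat ltnS.
  exact: Ni.
Qed.

End Separable.

(** * Passage to limits and the equivalence *)

Lemma amplify_scalar (R : realType) (S T : opSystem R) (phi : {linear S -> T}) n
    (s : matsp T n -> R[i]) :
  scalar s -> scalar (s \o amplify phi (n := n)).
Proof.
move=> sl a A B /=; rewrite -sl; congr s.
by apply/matrixP => i j; rewrite !mxE linearP.
Qed.

(** In [R[i]], [0 <= z] means zero imaginary and nonnegative real part. A failure at [s A] keeps it
    at distance at least [|Im (s A)|], respectively [- Re (s A)], from every nonnegative number,
    against convergence. *)
Lemma weak_star_limit_ge0 (R : realType) (S : opSystem R) n
    (P : (matsp S n -> R[i]) -> Prop) s A :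
  (forall q, P q -> 0 <= q A) -> weak_star_limit P s -> 0 <= s A.
Proof.
move=> P0 [I [le [f [le_dir fP fs]]]].
have lePF := net_filter_proper le_dir.
have fA0 i : 0 <= f i A by apply: P0.
have normc_Re (z : R[i]) : `|complex.Re z| <= normc z.
  by rewrite -lecR; apply: normc_ge_Re.
have normc_Im (z : R[i]) : `|complex.Im z| <= normc z.
  rewrite -normrN -ReiNIm; apply: le_trans (normc_Re _) _.
  by rewrite normcM /normc /= expr0n expr1n add0r sqrtr1 mulr1.
have le_dist (r : R) : 0 < r -> exists2 z : R[i], 0 <= z & normc (s A - z) < r.
  move=> r0; have /cvgrPdist_lt/(_ r%:C) := fs A; rewrite ltcR r0.
  move=> /(_ isT)[i _ /(_ i)]; have [_ le_refl _ _] := le_dir.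
  by move=> /(_ (le_refl i)) /=; rewrite ltcR => ?; exists (f i A).
rewrite lecE /=; apply/andP; split.
  apply: contrapT => /negP; rewrite -normr_gt0 => /le_dist[[a b]].
  rewrite lecE /= => /andP[/eqP-> _]; rewrite ltNge => /negP; apply.
  by apply: le_trans (normc_Im _); case: (s A) => c d /=; rewrite subr0.
rewrite leNgt; apply/negP; rewrite -oppr_gt0 => /le_dist[[a b]].
rewrite lecE /= => /andP[_ a0]; rewrite ltNge => /negP; apply.
apply: le_trans (normc_Re _); case: (s A) => c d /=.
by rewrite -normrN; apply: le_trans (ler_norm _); lra.
Qed.

Theorem theorem6p15 (R : realType) (S T : opSystem R)
    (phi : {linear S -> T}) :
  weak_star_entanglement_breaking phi <->
  completely_positive (phi : {linear OMIN S -> T}).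
Proof.
split=> [EB n A n0 mA|CP n s n0 [sl s0]].
  apply: positive_separation => // s ps.
  have [_] := EB n s n0 ps; apply: weak_star_limit_ge0 => q sq.
  exact: separable_min_cone sq mA.
(* The cones of [OMIN S] are [min_cone] by definition, so complete positivity applies to [A]
   directly. *)
have sphi0 A : min_cone A -> 0 <= (s \o amplify phi (n := n)) A.
  by move=> mA; apply: s0; apply: CP.
have sphil := amplify_scalar phi sl.
split; last exact: min_positive_weak_star_limit.
by split=> // A KA; apply: sphi0; apply: os_cone_min_cone.
Qed.
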